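(* Let $n\in\mathbb{N}$, $n\ge1$, let $1\le p<\infty$, and let $q$ be determined by $1/p+1/q=1$ if $p>1$ and $q=\infty$ if $p=1$. Any continuous linear functional $x^*\in L^*_{p,\lim}(\mathbb{R}_+,\mathbb{R}^n)$ can be uniquely represented in the form $$\langle x^*,x(\cdot)\rangle=\int_0^\infty\langle y(t),x(t)-x(\infty)\rangle\,dt+\alpha^T x(\infty)\qquad\text{for all } x(\cdot)\in L_{p,\lim}(\mathbb{R}_+,\mathbb{R}^n),$$ with $y(\cdot)\in L_q(\mathbb{R}_+,\mathbb{R}^n)$ and $\alpha\in\mathbb{R}^n$.
   Context: $\mathbb{R}_+=[0,\infty)$. For $1\le p<\infty$, $$L_{p,\lim}(\mathbb{R}_+,\mathbb{R}^n)=\{x(\cdot):\mathbb{R}_+\to\mathbb{R}^n \mid x(t)=x_0(t)+a,\ x_0(\cdot)\in L_p(\mathbb{R}_+,\mathbb{R}^n),\ a\in\mathbb{R}^n\}$$ (functions identified if equal almost everywhere), with norm $\|x(\cdot)\|_{L_{p,\lim}}^p=\|x_0(\cdot)\|_{L_p}^p+\|a\|^p$. The representation $x=x_0+a$ is unique, and $x(\infty):=a$, which is the $\lambda$-limit of $x$ at infinity: for every $\varepsilon>0$, $\lim_{N\to\infty}\lambda(\{t\ge N \mid \|x(t)-a\|\ge\varepsilon\})=0$, with $\lambda$ the Lebesgue measure. $L^*_{p,\lim}$ denotes the topological dual. *)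

(* Defs.v *)
From HB Require Import structures.
From mathcomp Require Import all_boot all_order all_algebra.
From mathcomp Require Import all_classical all_reals all_analysis.
From mathcomp Require Import measurable_realfun.

Set Implicit Arguments.
Unset Strict Implicit.
Unset Printing Implicit Defensive.

Import Order.TTheory GRing.Theory Num.Def Num.Theory.
Import numFieldNormedType.Exports.

Local Open Scope classical_set_scope.
Local Open Scope ring_scope.

Section Euclidean.
Context {R : realType} {n : nat}.
Implicit Types u v : 'cV[R]_n.

Definition dotv u v : R := (u^T *m v) 0 0.

(* Not the norm `|v| of the library on matrices, which is the sup norm. *)
Definition enorm v : R := Num.sqrt (dotv v v).

Lemma dotvE u v : dotv u v = \sum_i u i 0 * v i 0.
Proof. by rewrite /dotv mxE; apply: eq_bigr => i _; rewrite mxE. Qed.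

Lemma le_coord_enorm v i : `|v i 0| <= enorm v.
Proof.
rewrite /enorm dotvE -sqrtr_sqr ler_wsqrtr// (bigD1 i)//= -expr2 lerDl.
by apply: sumr_ge0 => j _; rewrite -expr2 sqr_ge0.
Qed.

End Euclidean.

Section LebesgueRplus.
Context {R : realType}.

Definition Rplus : set (measurableTypeR R) := `[0, +oo[%classic.

Lemma measurable_Rplus : measurable Rplus.
Proof. exact: measurable_itv. Qed.

(* Functions on R_+ are represented by functions on the whole line taken up to
   equality almost everywhere for this measure, for which the negative
   half-line is negligible. *)
Definition lebesgue_Rplus : {measure set (measurableTypeR R) -> \bar R} :=
  mrestr (@lebesgue_measure R) measurable_Rplus.

Lemma lebesgue_RplusT : lebesgue_Rplus [set: R] = +oo%E.
Proof.
by rewrite /lebesgue_Rplus /= /mrestr setTI lebesgue_measure_itv/= ltry.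
Qed.

End LebesgueRplus.

Section Lplim.
Context {R : realType} {n : nat}.
Implicit Types (x z : measurableTypeR R -> 'cV[R]_n) (a : 'cV[R]_n) (p : R).

Definition Lp (q : \bar R) x : Prop :=
  (forall i, measurable_fun [set: measurableTypeR R] (fun t => x t i 0)) /\
  finite_norm lebesgue_Rplus q (fun t => enorm (x t)).

Definition Lp_norm (q : \bar R) x : R :=
  fine ('N[lebesgue_Rplus]_q[EFin \o (fun t => enorm (x t))])%E.

Definition Lplim p x : Prop := exists a, Lp p%:E (x - cst a).

Definition at_infty p x : 'cV[R]_n := xget 0 [set a | Lp p%:E (x - cst a)].

Definition Lplim_norm p x : R :=
  (Lp_norm p%:E (x - cst (at_infty p x)) `^ p + enorm (at_infty p x) `^ p)
    `^ p^-1.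

(* The continuous linear functionals on the normed space of the classes of
   Lplim modulo equality almost everywhere, the values of F outside of Lplim
   being irrelevant. *)
Definition Lplim_dual p (F : (measurableTypeR R -> 'cV[R]_n) -> R) : Prop :=
  [/\ forall x z, Lplim p x -> Lplim p z ->
        x = z %[ae lebesgue_Rplus] -> F x = F z,
      forall (c : R) x z, Lplim p x -> Lplim p z ->
        F (c *: x + z) = c * F x + F z
    & forall x, Lplim p x -> forall e : R, 0 < e -> exists2 d : R, 0 < d &
        forall z, Lplim p z -> Lplim_norm p (z - x) < d -> `|F z - F x| < e].

Lemma Lp_coord p x i : 1 <= p -> Lp p%:E x ->
  (fun t => x t i 0) \in Lfun lebesgue_Rplus p%:E.
Proof.
move=> p1 [mx fx]; rewrite inE; apply/andP; split; rewrite inE//=.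
apply: le_lt_trans fx; rewrite unlock.
have p0 : 0 < p := lt_le_trans ltr01 p1.
have me : measurable_fun [set: measurableTypeR R] (fun t => enorm (x t)).
  have -> : (fun t => enorm (x t)) = Num.sqrt \o (fun t => \sum_i x t i 0 * x t i 0).
    by apply/funext => t /=; rewrite /enorm dotvE.
  apply: measurableT_comp.
      exact: continuous_measurable_fun (@sqrt_continuous R).
  by apply: measurable_sum => j; exact: measurable_funM.
have mpow (f : measurableTypeR R -> R) : measurable_fun setT f ->
    measurable_fun setT (fun t => (`|(f t)%:E| `^ p)%E).
  move=> mf; apply/measurable_EFinP.
  apply: (@measurableT_comp _ _ _ _ _ _ (@powR R ^~ p)) => //.
  exact: measurableT_comp.
have int_ge0 (f : measurableTypeR R -> R) :
    (0 <= \int[lebesgue_Rplus]_t (`|(f t)%:E| `^ p))%E.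
  by apply: integral_ge0 => t _ /=; rewrite lee_fin powR_ge0.
apply: gt0_ler_poweR; rewrite ?invr_ge0 ?(ltW p0)//.
- by rewrite in_itv /= leey andbT; exact: int_ge0.
- by rewrite in_itv /= leey andbT; exact: int_ge0.
apply: ge0_le_integral => //.
- by move=> t _ /=; rewrite lee_fin powR_ge0.
- exact: mpow.
- exact: mpow.
move=> t _ /=; rewrite lee_fin ge0_ler_powR// ?nnegrE ?(ltW p0)//.
by apply: le_trans (le_coord_enorm _ i) (ler_norm _).
Qed.

Lemma at_infty_unique p x a b : 1 <= p ->
  Lp p%:E (x - cst a) -> Lp p%:E (x - cst b) -> a = b.
Proof.
move=> p1 xa xb; have p0 : 0 < p := lt_le_trans ltr01 p1.
apply/matrixP => i j; rewrite (ord1 j) {j}; apply/eqP; rewrite -subr_eq0.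
have p1E : (1 <= p%:E)%E by rewrite lee_fin.
have := Lfun_submod_closed lebesgue_Rplus p1E => -[_ /(_ (-1))].
move=> /(_ _ _ (Lp_coord i p1 xa) (Lp_coord i p1 xb)).
set f := (X in X \in _); have -> : f = cst (a i 0 - b i 0).
  apply/funext => t; rewrite /f /=.
  by rewrite scaleN1r !fctE /cst !mxE opprB addrA subrK.
rewrite inE => /andP[_]; rewrite inE /= /finite_norm unlock.
move=> fin; apply/negPn/negP => ab0.
have : (\int[lebesgue_Rplus]_t (cst (`|a i 0 - b i 0| `^ p)%:E t) < +oo)%E.
  by apply: lty_poweRy fin; rewrite gt_eqF ?invr_gt0.
rewrite integral_cst// lebesgue_RplusT gt0_muley// lte_fin.
by rewrite powR_gt0 ?normr_gt0.
Qed.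

Lemma at_inftyE p x a : 1 <= p -> Lp p%:E (x - cst a) -> at_infty p x = a.
Proof.
move=> p1 xa; apply: (at_infty_unique p1 _ xa).
by rewrite /at_infty; case: xgetP => [b _ //|/(_ a)].
Qed.

End Lplim.

(* Main.v *)
Require Import Defs.
From HB Require Import structures.
From mathcomp Require Import all_boot all_order all_algebra.
From mathcomp Require Import all_classical all_reals all_analysis.
From mathcomp Require Import measurable_realfun ess_sup_inf.
From mathcomp Require Import ring.

Set Implicit Arguments.
Unset Strict Implicit.
Unset Printing Implicit Defensive.

Import Order.TTheory GRing.Theory Num.Def Num.Theory.
Import numFieldNormedType.Exports.

Local Open Scope classical_set_scope.
Local Open Scope ring_scope.

(** The theorem is the duality between L_p and L_q for a finite p, applied to
    each coordinate, together with the splitting of L_{p,lim} into L_p and the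
    constant functions. Write x = (x - a) + a with a = x(oo). On constants a
    linear functional is a |-> alpha^T a, where the entries of alpha are the
    values of F on the constant functions equal to basis vectors. On L_p, the
    space L_{p,lim} has the L_p norm, so that f |-> F (f e_i) is a bounded
    functional on the scalar L_p space, given by a kernel g_i in L_q by
    [Lfun_riesz_representation]; the g_i are the coordinates of y. Uniqueness
    comes from testing against constants for alpha, and against functions f e_i
    with f in L_p for y ([Lp_dual_separation]).

    The scalar representation theorem is proved for any sigma-finite measure mu.
    Such a measure has an integrable weight w with 0 < w <= 1
    ([sigma_finite_weight]). As w 1_E is then in L_p for every measurable E, the
    formula nu E = G (w 1_E) defines a finite signed measure on the whole space,
    and it is absolutely continuous. If h is its Radon-Nikodym density and
    g = h / w, then G (w s) is the integral of w s g for all simple functions s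
    ([representation_sfun]). Every nonnegative f is an increasing limit of
    functions w s ([weighted_approximation]). Taking s with the sign of g, the
    monotone convergence theorem bounds the integral of f |g| by C times the
    norm of f ([representation_ge0_bound]). This has two consequences: f g is
    integrable, hence G f is the integral of f g by dominated convergence
    ([representation_ge0]), and g is in L_q by the choice of an extremal f
    ([Lfun_hoelder_conjugate_of_dual_bound]). In these choices of f the weight
    serves again: it cuts down sets and functions to a finite norm while
    vanishing nowhere. *)

(** * Norms and convergence in L_p *)

Lemma normr_cvg_le {R : realType} (u : nat -> R) (l b : R) :
  u n @[n --> \oo] --> l -> (forall n, `|u n| <= b) -> `|l| <= b.
Proof.
move=> /cvg_norm cu ub; rewrite -(cvg_lim (@Rhausdorff R) cu); apply: limr_le.
  by apply/cvg_ex; exists `|l|.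
exact: nearW.
Qed.

Lemma powR_cvg_to0 {R : realType} (u : nat -> R) (r : R) : 0 < r ->
  (forall n, 0 <= u n) -> u n @[n --> \oo] --> 0 ->
  u n `^ r @[n --> \oo] --> 0.
Proof.
move=> r0 u0 cu; apply/cvgr0Pnorm_lt => e e0.
have : \forall n \near \oo, `|u n| < e `^ r^-1.
  by move/cvgr0Pnorm_lt : cu; apply; rewrite powR_gt0.
apply: filterS => n; rewrite !ger0_norm ?powR_ge0// => ue.
rewrite -[ltRHS]powRr1 ?ltW// -(@mulVf _ r) ?gt_eqF// powRrM.
by rewrite gt0_ltr_powR// nnegrE ?powR_ge0.
Qed.

Lemma poweR_cvg_to0 {R : realType} (u : nat -> \bar R) (r : R) : 0 < r ->
  (forall n, 0 <= u n)%E -> (u n @[n --> \oo] --> 0)%E ->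
  (u n `^ r @[n --> \oo] --> 0)%E.
Proof.
move=> r0 u0 /fine_cvgP[ufin cu]; apply/fine_cvgP; split.
  by apply: filterS ufin => n; exact: fin_num_poweR.
have -> : fine \o (fun n => (u n `^ r)%E) = (fun n => fine (u n) `^ r).
  by apply/funext => n /=; rewrite fine_poweR.
by apply: powR_cvg_to0 => // n; rewrite fine_ge0.
Qed.

Section Lfun_order.
Context d (T : measurableType d) (R : realType).
Variable mu : {measure set T -> \bar R}.
Implicit Types (f g : T -> R).

Lemma Lfun_measurable {p : \bar R} {f} : f \in Lfun mu p ->
  measurable_fun [set: T] f.
Proof. by rewrite inE => /andP[/[!inE]]. Qed.

Lemma Lfun_finite_norm {p : \bar R} {f} : f \in Lfun mu p ->
  ('N[mu]_p[EFin \o f] < +oo)%E.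
Proof. by rewrite inE => /andP[_ /[!inE]]. Qed.

Lemma measurable_normr_powR (r : R) f : measurable_fun [set: T] f ->
  measurable_fun [set: T] (fun t => (`|f t| `^ r)%:E).
Proof.
move=> mf; apply/measurable_EFinP.
apply: (@measurableT_comp _ _ _ _ _ _ (@powR R ^~ r)) => //.
exact: measurableT_comp.
Qed.

Lemma integral_powR_ge0 (r : R) f : (0 <= \int[mu]_t (`|f t| `^ r)%:E)%E.
Proof. by apply: integral_ge0 => t _; rewrite lee_fin powR_ge0. Qed.

Lemma LnormE_fin (r : R) f :
  ('N[mu]_r%:E[EFin \o f] = (\int[mu]_t (`|f t| `^ r)%:E) `^ r^-1)%E.
Proof. by rewrite unlock. Qed.

Lemma le_Lnorm (p : \bar R) f g : (1 <= p)%E ->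
  measurable_fun [set: T] f -> measurable_fun [set: T] g ->
  (forall t, `|f t| <= `|g t|) ->
  ('N[mu]_p[EFin \o f] <= 'N[mu]_p[EFin \o g])%E.
Proof.
case: p => [r||//] r1 mf mg fg; last first.
  rewrite unlock /Lnorm; case: ifPn => // _.
  by apply: le_ess_sup; apply: nearW => t /=; rewrite lee_fin.
have r0 : 0 <= r by rewrite (le_trans ler01).
rewrite !LnormE_fin; apply: gt0_ler_poweR; rewrite ?invr_ge0//.
- by rewrite in_itv /= leey andbT integral_powR_ge0.
- by rewrite in_itv /= leey andbT integral_powR_ge0.
apply: ge0_le_integral => //.
- exact: measurable_normr_powR.
- exact: measurable_normr_powR.
by move=> t _; rewrite lee_fin ge0_ler_powR// nnegrE.
Qed.

Lemma Lfun_le (p : \bar R) f g : (1 <= p)%E -> measurable_fun [set: T] f ->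
  (forall t, `|f t| <= `|g t|) -> g \in Lfun mu p -> f \in Lfun mu p.
Proof.
move=> p1 mf fg Lg; rewrite inE; apply/andP; split; rewrite inE//=.
apply: le_lt_trans (Lfun_finite_norm Lg).
exact: le_Lnorm p1 mf (Lfun_measurable Lg) fg.
Qed.

Lemma LfunZ (p : \bar R) c f : (1 <= p)%E -> f \in Lfun mu p ->
  c *: f \in Lfun mu p.
Proof.
move=> p1 Lf; have [L0 /(_ c f 0 Lf L0)] := Lfun_submod_closed mu p1.
by rewrite addr0.
Qed.

Lemma LfunD (p : \bar R) f g : (1 <= p)%E -> f \in Lfun mu p ->
  g \in Lfun mu p -> f + g \in Lfun mu p.
Proof.
move=> p1 Lf Lg; have [_ /(_ 1 f g Lf Lg)] := Lfun_submod_closed mu p1.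
by rewrite scale1r.
Qed.

Lemma LfunB (p : \bar R) f g : (1 <= p)%E -> f \in Lfun mu p ->
  g \in Lfun mu p -> f - g \in Lfun mu p.
Proof.
by move=> p1 Lf Lg; rewrite -scaleN1r LfunD// LfunZ.
Qed.

Lemma Lfun_sum (p : \bar R) (I : Type) (s : seq I) (f : I -> T -> R) :
  (1 <= p)%E -> (forall i, f i \in Lfun mu p) ->
  \sum_(i <- s) f i \in Lfun mu p.
Proof.
move=> p1 Lf; elim/big_ind : _ => [|u v Lu Lv|i _]; last exact: Lf.
- by have [] := Lfun_submod_closed mu p1.
- exact: LfunD.
Qed.

(** Powers of exponent at least one decrease the values in ]0, 1]. *)
Lemma Lfun_integrable_le1 (r : R) f : 1 <= r ->
  (forall t, 0 < f t <= 1) -> mu.-integrable [set: T] (EFin \o f) ->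
  f \in Lfun mu r%:E.
Proof.
move=> r1 f01 /integrableP[/measurable_EFinP mf fy].
rewrite inE; apply/andP; split; rewrite inE//= /finite_norm LnormE_fin.
apply: poweR_lty; apply: le_lt_trans fy; apply: ge0_le_integral => //.
- exact: measurable_normr_powR.
- by do 2 apply: measurableT_comp => //.
move=> t _ /=; have /andP[/ltW f0 _] := f01 t.
by rewrite !ger0_norm// lee_fin ge1r_powR.
Qed.

Lemma Lfun_finP (r : R) f : 1 <= r -> measurable_fun [set: T] f ->
  f \in Lfun mu r%:E <-> (\int[mu]_t (`|f t| `^ r)%:E < +oo)%E.
Proof.
move=> r1 mf; have r0 : 0 < r by rewrite (lt_le_trans ltr01).
split=> [/Lfun_finite_norm|].
  by rewrite LnormE_fin; apply: lty_poweRy; rewrite gt_eqF ?invr_gt0.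
move=> fy; rewrite inE; apply/andP; split; rewrite inE//= /finite_norm.
by rewrite LnormE_fin poweR_lty.
Qed.

(** The r-th powers of the differences are dominated by the integrable function
    (2 h)^r, so that the usual theorem for integrals applies to them. *)
Lemma Lnorm_dominated_cvg (r : R) (f_ : nat -> T -> R) f h : 1 <= r ->
  (forall n, measurable_fun [set: T] (f_ n)) -> measurable_fun [set: T] f ->
  h \in Lfun mu r%:E -> (forall n t, `|f_ n t| <= h t) ->
  (forall t, f_ n t @[n --> \oo] --> f t) ->
  ('N[mu]_r%:E[EFin \o (f_ n - f)%R] @[n --> \oo] --> 0)%E.
Proof.
move=> r1 mf_ mf Lh fh cf; have r0 : 0 < r by rewrite (lt_le_trans ltr01).
have fleh t : `|f t| <= h t by exact: normr_cvg_le (cf t) (fh ^~ t).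
have mB n : measurable_fun [set: T] (f_ n - f) by exact: measurable_funB.
have L2h : 2 *: h \in Lfun mu r%:E by rewrite LfunZ// lee_fin.
have cB : {ae mu, forall t, [set: T] t ->
    (`|(f_ n - f) t| `^ r)%:E @[n --> \oo] --> cst 0%E t}.
  apply/aeW => t _; apply: cvg_EFin; first exact: nearW.
  apply: powR_cvg_to0 => //; apply/norm_cvg0P/subr_cvg0.
  exact: cf.
have dB : {ae mu, forall t n, [set: T] t ->
    (`|(`|(f_ n - f) t| `^ r)%:E| <= (`|(2 *: h) t| `^ r)%:E)%E}.
  apply/aeW => t n _ /=; rewrite lee_fin ger0_norm ?powR_ge0//.
  rewrite ge0_ler_powR ?nnegrE ?(ltW r0)//.
  apply: le_trans (ler_normB _ _) _.
  apply: le_trans (lerD (fh n t) (fleh t)) _.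
  have -> : h t + h t = (2 *: h) t by rewrite -mulr2n -[LHS]mulr_natl.
  exact: ler_norm.
have [_ _] := dominated_convergence measurableT
  (fun n => measurable_normr_powR r (mB n)) (measurable_cst _)
  cB (Lfun_integrable r1 L2h) dB.
rewrite integral0 => c0.
under eq_fun do rewrite LnormE_fin.
by apply: poweR_cvg_to0; rewrite ?invr_gt0// => n; exact: integral_powR_ge0.
Qed.

End Lfun_order.

(** * Weights *)

Lemma measurable_inv_pos d (T : measurableType d) (R : realType) (w : T -> R) :
  measurable_fun [set: T] w -> (forall t, 0 < w t) ->
  measurable_fun [set: T] (fun t => (w t)^-1).
Proof.
move=> mw w0; have -> : (fun t => (w t)^-1) = (fun t => w t `^ (-1)).
  by apply/funext => t; rewrite powR_inv1// ltW.
exact: (@measurableT_comp _ _ _ _ _ _ (@powR R ^~ (-1))).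
Qed.

(** If the sets F k, of finite measure, cover the space, then the sum of the
    indicators of the F k with coefficients 2^-(k+1) / (1 + mu (F k)) is
    positive because the F k cover, and has its values and its integral bounded
    by the sum of the 2^-(k+1). *)
Lemma sigma_finite_weight d (T : measurableType d) (R : realType)
    (mu : {sigma_finite_measure set T -> \bar R}) :
  exists w : T -> R, (forall t, 0 < w t <= 1) /\
    mu.-integrable [set: T] (EFin \o w).
Proof.
have [F UF mF] := sigma_finiteT mu.
pose c k : R := (1 / (2 ^ k.+1)%:R) / (1 + fine (mu (F k))).
have d0 k : 0 < 1 + fine (mu (F k)).
  by rewrite (lt_le_trans ltr01)// lerDl fine_ge0.
have c0 k : 0 < c k by rewrite !divr_gt0// ltr0n expn_gt0.
have c1 k : c k <= 1 / (2 ^ k.+1)%:R.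
  by rewrite ler_pdivrMr// ler_peMr// ?divr_ge0// lerDl fine_ge0.
pose W t := (\sum_(k <oo) (c k * \1_(F k) t)%:E)%E.
have t0 k t : (0 <= (c k * \1_(F k) t)%:E)%E.
  by rewrite lee_fin mulr_ge0// ltW.
have W1 t : (W t <= 1)%E.
  apply: le_trans (epsilon_trick0 xpredT (@ler01 R)).
  apply: lee_nneseries => // k _.
  rewrite lee_fin; apply: le_trans (c1 k).
  by rewrite ler_piMr ?(ltW (c0 k))// indicE; case: (_ \in _).
have W0 t : (0 < W t)%E.
  have [k _ Fkt] : (\bigcup_i F i) t by rewrite -UF.
  have := @nneseries_lim_ge _ _ xpredT 0 k.+1 (fun k _ _ => t0 k t).
  apply: lt_le_trans; rewrite big_nat_recr//= indicE mem_set// mulr1.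
  rewrite (@lt_le_trans _ _ (c k)%:E) ?lte_fin// leeDr//.
  by apply: sume_ge0 => i _; exact: t0.
have Wfin t : W t \is a fin_num.
  by rewrite ge0_fin_numE ?(ltW (W0 t))// (le_lt_trans (W1 t))// ltry.
have mt k : measurable_fun [set: T] (fun t => (c k * \1_(F k) t)%:E).
  apply/measurable_EFinP; apply: measurable_funM => //.
  by apply: measurable_indic; have [] := mF k.
have mW : measurable_fun [set: T] W by exact: ge0_emeasurable_sum.
exists (fine \o W); split=> [t /=|].
  by rewrite -!lee_fin -lte_fin fineK// W0 W1.
have -> : EFin \o (fine \o W) = W by apply/funext => t /=; rewrite fineK.
apply/integrableP; split=> //.
under eq_integral do rewrite gee0_abs ?(ltW (W0 _))//.
rewrite integral_nneseries//.
apply: le_lt_trans (ltry 1).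
apply: le_trans (epsilon_trick0 xpredT (@ler01 R)).
apply: lee_nneseries => [k _ _|k _]; first exact: integral_ge0.
under eq_integral do rewrite EFinM.
have [mFk Fky] := mF k.
rewrite ge0_integralZl_EFin ?(ltW (c0 k))//; last first.
  by apply/measurable_EFinP; exact: measurable_indic.
have -> : (\int[mu]_t (\1_(F k) t)%:E)%E = (fine (mu (F k)))%:E.
  by rewrite integral_indic// setIT fineK// ge0_fin_numE.
rewrite -EFinM lee_fin.
by rewrite /c mulrAC ler_pdivrMr// ler_wpM2l ?divr_ge0// lerDr ler01.
Qed.

(** * Pairing of conjugate exponents *)

Lemma hoelder_conjugate_fin (R : realType) (p : R) : 1 < p ->
  hoelder_conjugate p%:E = (p / (p - 1))%:E.
Proof.
move=> p1; rewrite /hoelder_conjugate/= eqe gt_eqF ?(lt_trans ltr01)//.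
by rewrite -EFinD inver subr_eq0 gt_eqF// -EFinM.
Qed.

Lemma Lfun_pinfty_bounded d (T : measurableType d) (R : realType)
    (mu : {measure set T -> \bar R}) (g : T -> R) :
  g \in Lfun mu +oo%E -> exists M, {ae mu, forall t, `|g t| <= M}.
Proof.
move=> /Lfun_finite_norm; rewrite unlock /Lnorm; case: ifPn => [_ gy|mu0 _].
  have [M gM] := @ess_supr_bounded _ _ _ mu (normr \o g) gy.
  by exists M.
(* Here mu is the zero measure, for which every property holds almost
   everywhere. *)
exists 0; exists setT; split=> //.
by apply/eqP; rewrite eq_le measure_ge0 andbT leNgt.
Qed.

(** This is Hölder's inequality; for the exponents 1 and +oo, the product is
    bounded by a multiple of f almost everywhere. *)
Lemma Lfun_mul_integrable d (T : measurableType d) (R : realType)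
    (mu : {measure set T -> \bar R}) (p : R) (f g : T -> R) : 1 <= p ->
  f \in Lfun mu p%:E -> g \in Lfun mu (hoelder_conjugate p%:E) ->
  mu.-integrable [set: T] (fun t => (f t * g t)%:E).
Proof.
move=> p1 Lf Lg; have mf := Lfun_measurable Lf; have mg := Lfun_measurable Lg.
have mfg : measurable_fun [set: T] (fun t => f t * g t).
  exact: measurable_funM.
have mnfg : measurable_fun [set: T] (fun t => `|(f t * g t)%:E|%E).
  by apply: measurableT_comp => //; exact/measurable_EFinP.
move: p1; rewrite le_eqVlt => /predU1P[p1|p1].
  move: Lf Lg; rewrite -p1 hoelder_conjugate1.
  move=> /Lfun1_integrable/integrableP[_ fy].
  move=> /Lfun_pinfty_bounded[M gM].
  apply/integrableP; split; first exact/measurable_EFinP.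
  have mMf : measurable_fun [set: T] (fun t => (`|M| * `|f t|)%:E).
    by apply/measurable_EFinP; do 2 apply: measurableT_comp => //.
  apply: (@le_lt_trans _ _ (\int[mu]_t (`|M| * `|f t|)%:E)%E).
    apply: ae_ge0_le_integral => //.
    by apply: filterS gM => t gtM _; rewrite /= lee_fin mulrC normrM ler_wpM2r//
      (le_trans gtM) ?ler_norm.
  under eq_integral do rewrite EFinM.
  rewrite ge0_integralZl_EFin//; last first.
    by apply/measurable_EFinP; exact: measurableT_comp.
  by rewrite lte_mul_pinfty// lee_fin.
rewrite (hoelder_conjugate_fin p1) in Lg.
have p0 : 0 < p by rewrite (lt_trans ltr01).
have q0 : 0 < p / (p - 1) by rewrite divr_gt0// subr_gt0.
have pq : p^-1 + (p / (p - 1))^-1 = 1.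
  by rewrite invf_div -[X in X + _]mul1r -mulrDl subrKC divff// gt_eqF.
apply/integrableP; split; first exact/measurable_EFinP.
have := hoelder mu mf mg p0 q0 pq; rewrite Lnorm1; move/le_lt_trans; apply.
have := Lfun_finite_norm Lf; have := Lfun_finite_norm Lg.
rewrite -!ge0_fin_numE ?Lnorm_ge0 ?mule_ge0 ?Lnorm_ge0//.
by move=> ? ?; rewrite fin_numM.
Qed.

(** * Bounded functionals on L_p *)

(** The functional is a function of representatives, constrained on those of
    finite norm only; the bound makes it respect equality almost everywhere. *)
Definition bounded_linear_on d (T : measurableType d) (R : realType)
    (mu : {measure set T -> \bar R}) (p : \bar R) (C : R)
    (G : (T -> R) -> R) : Prop :=
  (forall c f g, f \in Lfun mu p -> g \in Lfun mu p ->
     G (c *: f + g) = c * G f + G g) /\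
  (forall f, f \in Lfun mu p ->
     (`|G f|%:E <= C%:E * 'N[mu]_p[EFin \o f])%E).

Section bounded_linear_on_theory.
Context d (T : measurableType d) (R : realType).
Context (mu : {measure set T -> \bar R}) (p : R) (p1 : 1 <= p).
Context (C : R) (G : (T -> R) -> R) (hG : bounded_linear_on mu p%:E C G).

Local Notation Lp := (Lfun mu p%:E).

Let p1E : (1 <= p%:E)%E. Proof. by rewrite lee_fin. Qed.

Let Lp0 : 0 \in Lp. Proof. by have [] := Lfun_submod_closed mu p1E. Qed.

Lemma bounded_linear_on0 : G 0 = 0.
Proof.
have [+ _] := hG => /(_ 1 0 0 Lp0 Lp0).
by rewrite scale1r addr0 mul1r -[X in X = _]addr0 => /addrI/esym.
Qed.

Lemma bounded_linear_onZ c f : f \in Lp -> G (c *: f) = c * G f.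
Proof.
by have [/(_ c f 0) + _] := hG => /[apply] /(_ Lp0);
  rewrite bounded_linear_on0 !addr0.
Qed.

Lemma bounded_linear_onD f g : f \in Lp -> g \in Lp -> G (f + g) = G f + G g.
Proof.
by have [/(_ 1 f g) + _] := hG => /[apply] /[apply]; rewrite scale1r mul1r.
Qed.

Lemma bounded_linear_onB f g : f \in Lp -> g \in Lp -> G (f - g) = G f - G g.
Proof.
move=> Lf Lg; rewrite -[- g]scaleN1r bounded_linear_onD ?LfunZ//.
by rewrite bounded_linear_onZ// mulN1r.
Qed.

Lemma bounded_linear_on_sum (I : Type) (s : seq I) (f : I -> T -> R) :
  (forall i, f i \in Lp) -> G (\sum_(i <- s) f i) = \sum_(i <- s) G (f i).
Proof.
move=> Lf; elim: s => [|i s IH]; first by rewrite !big_nil bounded_linear_on0.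
by rewrite !big_cons bounded_linear_onD ?IH// Lfun_sum.
Qed.

(** A functional bounded in norm is continuous for dominated pointwise
    convergence, because p is finite. *)
Lemma bounded_linear_on_cvg (f_ : nat -> T -> R) (f h : T -> R) :
  (forall n, measurable_fun [set: T] (f_ n)) -> measurable_fun [set: T] f ->
  h \in Lp -> (forall n t, `|f_ n t| <= h t) ->
  (forall t, f_ n t @[n --> \oo] --> f t) ->
  G (f_ n) @[n --> \oo] --> G f.
Proof.
move=> mf_ mf Lh fh cf.
have fleh t : `|f t| <= h t by exact: normr_cvg_le (cf t) (fh ^~ t).
have Lf_ n : f_ n \in Lp.
  by apply: Lfun_le Lh => // t; rewrite (le_trans (fh n t))// ler_norm.
have Lf : f \in Lp.
  by apply: Lfun_le Lh => // t; rewrite (le_trans (fleh t))// ler_norm.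
apply/subr_cvg0/norm_cvg0P.
have cN := Lnorm_dominated_cvg p1 mf_ mf Lh fh cf.
have cCN : (C%:E * 'N[mu]_p%:E[EFin \o (f_ n - f)%R] @[n --> \oo] --> 0)%E.
  by rewrite -[X in _ --> X](mule0 C%:E); apply: cvgeZl.
have : (`|G (f_ n) - G f|%:E @[n --> \oo] --> 0)%E.
  apply: (@squeeze_cvge _ _ _ _ (cst 0%E) _
    (fun n => C%:E * 'N[mu]_p%:E[EFin \o (f_ n - f)%R])%E) => //.
  - apply: nearW => n; rewrite lee_fin normr_ge0/=.
    by rewrite -bounded_linear_onB//; apply: (proj2 hG); exact: LfunB.
  - exact: cvg_cst.
by move/fine_cvgP => [_].
Qed.

End bounded_linear_on_theory.

(** * The kernel of a functional *)

Section density.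
Context d (T : measurableType d) (R : realType).
Context (mu : {sigma_finite_measure set T -> \bar R}) (p : R) (p1 : 1 <= p).
Context (C : R) (G : (T -> R) -> R) (hG : bounded_linear_on mu p%:E C G).
Context (w : T -> R) (w01 : forall t, 0 < w t <= 1).
Context (iw : mu.-integrable [set: T] (EFin \o w)).

Local Notation Lp := (Lfun mu p%:E).

Let p1E : (1 <= p%:E)%E. Proof. by rewrite lee_fin. Qed.

Let Lw : w \in Lp. Proof. exact: Lfun_integrable_le1. Qed.

Let mw : measurable_fun [set: T] w. Proof. exact: Lfun_measurable Lw. Qed.

Let w0 t : 0 < w t. Proof. by have /andP[] := w01 t. Qed.

Let mwi (E : set T) : measurable E -> measurable_fun [set: T] (w \* \1_E).
Proof. by move=> mE; apply: measurable_funM => //; exact: measurable_indic. Qed.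

Let le_wi (E : set T) t : `|(w \* \1_E) t| <= w t.
Proof.
rewrite /= normrM (ger0_norm (ltW (w0 t))) ler_piMr ?(ltW (w0 t))// indicE.
by case: (_ \in _); rewrite ?normr1 ?normr0.
Qed.

Let Lwi (E : set T) : measurable E -> w \* \1_E \in Lp.
Proof.
move=> mE; apply: Lfun_le Lw => //; first exact: mwi.
by move=> t; rewrite (le_trans (le_wi E t))// ler_norm.
Qed.

Let nu (E : set T) : \bar R := (G (w \* \1_E))%:E.

Let nu0 : nu set0 = 0%E.
Proof.
rewrite /nu; have -> : w \* \1_set0 = 0 :> (T -> R).
  by apply/funext => t; rewrite /= indicE in_set0 mulr0.
by rewrite (bounded_linear_on0 p1 hG).
Qed.

(* The partial sums of the indicators of disjoint sets converge to the indicator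
   of the union and, multiplied by w, they are dominated by w. *)
Let nu_sigma_additive : semi_sigma_additive nu.
Proof.
move=> F mF tF mU; rewrite /nu.
pose f_ n : T -> R := \sum_(0 <= i < n) (w \* \1_(F i)).
have f_E n t : f_ n t = w t * \sum_(0 <= i < n) \1_(F i) t.
  by rewrite /f_ fct_sumE mulr_sumr.
have -> : (fun n => (\sum_(0 <= i < n) (G (w \* \1_(F i)))%:E)%E) =
    (fun n => (G (f_ n))%:E).
  apply/funext => n; rewrite sumEFin; congr EFin.
  by rewrite (bounded_linear_on_sum p1 hG)// => i; exact: Lwi.
apply: cvg_EFin; first exact: nearW.
have i0 i t : (0%R <= (\1_(F i) t)%:E :> \bar R)%E by rewrite lee_fin.
have le1 n t : \sum_(0 <= i < n) \1_(F i) t <= 1 :> R.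
  rewrite -lee_fin -sumEFin.
  apply: le_trans (nneseries_lim_ge n (fun k _ _ => i0 k t)) _.
  by rewrite -indic_bigcup// lee_fin indicE; case: (_ \in _).
apply: (bounded_linear_on_cvg p1 hG _ _ Lw).
- move=> n; have -> : f_ n = fun t => w t * \sum_(0 <= i < n) \1_(F i) t.
    exact/funext.
  apply: measurable_funM => //; apply: measurable_sum => i.
  exact: measurable_indic.
- exact: mwi.
- move=> n t; rewrite f_E normrM (ger0_norm (ltW (w0 t))).
  by rewrite ler_piMr ?(ltW (w0 t))// ger0_norm// sumr_ge0.
- move=> t; under eq_fun do rewrite f_E.
  apply: cvgM; first exact: cvg_cst.
  have /fine_cvgP[_] : (\sum_(0 <= i < n) (\1_(F i) t)%:E @[n --> \oo] -->
      (\1_(\bigcup_n F n) t : R)%:E)%E.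
    rewrite indic_bigcup//; apply: is_cvg_nneseries => i _ _; exact: i0.
  by under eq_fun do rewrite /= sumEFin.
Qed.

(** The set function sending E to G (w 1_E) is finite, countably additive and
    vanishes on null sets, so it has a density h with respect to mu; the
    function representing G is then h / w. *)
Lemma bounded_linear_on_density : exists g : T -> R,
  [/\ measurable_fun [set: T] g,
      mu.-integrable [set: T] (fun t => (w t * g t)%:E)
    & forall E, measurable E ->
        G (w \* \1_E) = \int[mu]_t (w t * \1_E t * g t)].
Proof.
have nufin E : measurable E -> nu E \is a fin_num by [].
pose nuC : {charge set T -> \bar R} :=
  HB.pack nu (isCharge.Build _ _ _ nu nu0 nufin nu_sigma_additive).
have numu : nuC `<< mu.
  apply/null_content_dominatesP => E mE muE; rewrite /= /nu.
  have [_ /(_ _ (Lwi mE))] := hG.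
  suff -> : 'N[mu]_p%:E[EFin \o (w \* \1_E)%R]%E = 0%E.
    by rewrite mule0 lee_fin normr_le0 => /eqP ->.
  rewrite LnormE_fin.
  have -> : (\int[mu]_t (`|(w \* \1_E)%R t| `^ p)%:E =
      \int[mu]_(t in E) (`|(w \* \1_E)%R t| `^ p)%:E)%E.
    rewrite [RHS]integral_mkcond; apply: eq_integral => t _.
    rewrite patchE /= indicE; case: (_ \in _) => //.
    by rewrite mulr0 normr0 powR0// gt_eqF// (lt_le_trans ltr01).
  rewrite (null_set_integral mE _ muE); last first.
    exact: measurable_funTS (measurable_normr_powR p (mwi mE)).
  by rewrite poweR0r// invr_neq0// gt_eqF// (lt_le_trans ltr01).
pose h := Radon_Nikodym nuC mu.
have hfin t : h t \is a fin_num := Radon_Nikodym_fin_num t numu.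
have ih : mu.-integrable [set: T] h := Radon_Nikodym_integrable numu.
have mh : measurable_fun [set: T] (fine \o h).
  by apply: measurableT_comp => //; exact: measurable_int ih.
have wg t : w t * (fine (h t) / w t) = fine (h t).
  by rewrite mulrC divfK// gt_eqF.
exists (fun t => fine (h t) / w t); split.
- apply: measurable_funM => //.
  exact: measurable_inv_pos.
- by under eq_fun do rewrite wg fineK//.
move=> E mE; rewrite /Rintegral; have -> :
    (\int[mu]_t (w t * \1_E t * (fine (h t) / w t))%:E = nu E)%E; last by [].
rewrite -[nu E]/(nuC E) (Radon_Nikodym_integral numu mE) -/h.
rewrite [RHS]integral_mkcond; apply: eq_integral => t _.
rewrite mulrAC wg patchE indicE.
by case: (_ \in _); rewrite ?mulr1 ?mulr0 ?fineK.
Qed.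

End density.

(** * The integral formula *)

Lemma integrable_EFin_sum d (T : measurableType d) (R : realType)
    (mu : {measure set T -> \bar R}) (I : Type) (s : seq I) (f : I -> T -> R) :
  (forall i, mu.-integrable [set: T] (fun t => (f i t)%:E)) ->
  mu.-integrable [set: T] (fun t => (\sum_(i <- s) f i t)%:E).
Proof.
move=> If; elim: s => [|i s IH].
  by under eq_fun do rewrite big_nil; exact: integrable0.
under eq_fun do rewrite big_cons EFinD.
by apply: integrableD.
Qed.

Lemma Rintegral_sum d (T : measurableType d) (R : realType)
    (mu : {measure set T -> \bar R}) (I : Type) (s : seq I) (f : I -> T -> R) :
  (forall i, mu.-integrable [set: T] (fun t => (f i t)%:E)) ->
  \int[mu]_t (\sum_(i <- s) f i t) = \sum_(i <- s) \int[mu]_t f i t.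
Proof.
move=> If; elim: s => [|i s IH].
  by rewrite big_nil; under eq_Rintegral do rewrite big_nil;
    rewrite Rintegral_cst// mul0r.
rewrite big_cons -IH -RintegralD//; [|exact: If|exact: integrable_EFin_sum].
by under eq_Rintegral do rewrite big_cons.
Qed.

Section simple_approximation.
Import HBSimple HBNNSimple.

Lemma sign_sfun d (T : measurableType d) (R : realType) (g : T -> R) :
  measurable_fun [set: T] g ->
  exists s : {sfun T >-> R}, forall t, s t = (-1) ^+ (g t < 0)%R.
Proof.
move=> mg; have mP : measurable [set t | 0 <= g t].
  by rewrite -[X in measurable X]setTI; exact: measurable_fun_le.
have mN : measurable [set t | ~ 0 <= g t] by exact: measurableC.
exists (indic_sfun _ mP - indic_sfun _ mN) => t.
rewrite sfunB /= !mindicE ltNge.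
case: (boolP (0 <= g t)) => gt0.
  by rewrite mem_set// memNset ?subr0// => /(_ gt0).
by rewrite memNset ?mem_set ?sub0r//; exact/negP.
Qed.

(** Any nonnegative function is an increasing limit of simple multiples of the
    weight, because it can be divided by the weight. *)
Lemma weighted_approximation d (T : measurableType d) (R : realType)
    (w f : T -> R) :
  measurable_fun [set: T] w -> (forall t, 0 < w t) ->
  measurable_fun [set: T] f -> (forall t, 0 <= f t) ->
  exists s : nat -> {sfun T >-> R},
    [/\ forall n t, 0 <= s n t,
        forall t m n, (m <= n)%N -> s m t <= s n t,
        forall n t, w t * s n t <= f t
      & forall t, w t * s n t @[n --> \oo] --> f t].
Proof.
move=> mw w0 mf f0; pose u t := (f t / w t)%:E.
have mu' : measurable_fun [set: T] u.
  apply/measurable_EFinP; apply: measurable_funM => //.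
  exact: measurable_inv_pos.
have u0 t : [set: T] t -> (0 <= u t)%E.
  by move=> _; rewrite lee_fin divr_ge0// ltW.
pose s n : {sfun T >-> R} := nnsfun_approx measurableT mu' n.
have sE n t : s n t = approx [set: T] u n t.
  by rewrite -(nnsfun_approxE measurableT mu').
exists s; split.
- by move=> n t; exact: fun_ge0.
- by move=> t m n mn; have /lefP := nd_nnsfun_approx measurableT mu' mn; exact.
- move=> n t; rewrite mulrC -ler_pdivlMr// -lee_fin sE.
  exact: le_approx.
- move=> t; have -> : f t = w t * fine (u t).
    by rewrite /= mulrC divfK// gt_eqF.
  apply: cvgM; first exact: cvg_cst.
  under eq_fun do rewrite sE.
  by apply: cvg_approx => //; rewrite ltry.
Qed.

End simple_approximation.

Section representation.
Context d (T : measurableType d) (R : realType).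
Context (mu : {measure set T -> \bar R}) (p : R) (p1 : 1 <= p).
Context (C : R) (G : (T -> R) -> R) (hG : bounded_linear_on mu p%:E C G).
Context (C0 : 0 <= C).
Context (w : T -> R) (w01 : forall t, 0 < w t <= 1).
Context (iw : mu.-integrable [set: T] (EFin \o w)).
Context (g : T -> R) (mg : measurable_fun [set: T] g).
Context (iwg : mu.-integrable [set: T] (fun t => (w t * g t)%:E)).
Context (GE : forall E, measurable E ->
  G (w \* \1_E) = \int[mu]_t (w t * \1_E t * g t)).

Local Notation Lp := (Lfun mu p%:E).

Let p1E : (1 <= p%:E)%E. Proof. by rewrite lee_fin. Qed.

Let Lw : w \in Lp. Proof. exact: Lfun_integrable_le1. Qed.

Let mw : measurable_fun [set: T] w. Proof. exact: Lfun_measurable Lw. Qed.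

Let w0 t : 0 < w t. Proof. by have /andP[] := w01 t. Qed.

Import HBSimple.

Let Lwi (E : set T) : measurable E -> w \* \1_E \in Lp.
Proof.
move=> mE; apply: Lfun_le Lw => //.
  by apply: measurable_funM => //; exact: measurable_indic.
move=> t; rewrite /= normrM ler_piMr// indicE.
by case: (_ \in _); rewrite ?normr1 ?normr0.
Qed.

Let iwig (E : set T) : measurable E ->
  mu.-integrable [set: T] (fun t => (w t * \1_E t * g t)%:E).
Proof.
move=> mE; apply: le_integrable iwg => //.
  apply/measurable_EFinP; apply: measurable_funM => //.
  by apply: measurable_funM => //; exact: measurable_indic.
move=> t _; rewrite /= lee_fin mulrAC normrM ler_piMr// indicE.
by case: (_ \in _); rewrite ?normr1 ?normr0.
Qed.

(** A simple function is a linear combination of indicators, for which the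
    formula holds by the choice of g. *)
Lemma representation_sfun (s : {sfun T >-> R}) :
  [/\ w \* s \in Lp,
      mu.-integrable [set: T] (fun t => (w t * s t * g t)%:E)
    & G (w \* s) = \int[mu]_t (w t * s t * g t)].
Proof.
pose l := finmap.enum_fset (fset_set (range s)).
pose n := size l.
pose a (i : 'I_n) := l`_i.
pose A (i : 'I_n) := s @^-1` [set a i].
have sE t : s t = \sum_(i < n) a i * \1_(A i) t := fimfunEord s t.
have mA i : measurable (A i) by exact: measurable_sfunP.
have iaA i : mu.-integrable [set: T]
    (fun t => (a i * (w t * \1_(A i) t * g t))%:E).
  by under eq_fun do rewrite EFinM; apply: integrableZl => //; exact: iwig.
have -> : w \* s = \sum_(i < n) (a i *: (w \* \1_(A i))).
  apply/funext => t; rewrite fct_sumE /= sE mulr_sumr.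
  by apply: eq_bigr => i _; rewrite /= mulrCA.
have sgE t : w t * s t * g t = \sum_(i < n) a i * (w t * \1_(A i) t * g t).
  rewrite sE mulr_sumr mulr_suml.
  by apply: eq_bigr => i _; rewrite (mulrCA (w t)) !mulrA.
split.
- by apply: Lfun_sum => // i; apply: LfunZ => //; exact: Lwi.
- by under eq_fun do rewrite sgE; exact: integrable_EFin_sum.
rewrite (bounded_linear_on_sum p1 hG); last first.
  by move=> i; apply: LfunZ => //; exact: Lwi.
under eq_Rintegral do rewrite sgE.
rewrite Rintegral_sum//; apply: eq_bigr => i _.
rewrite (bounded_linear_onZ p1 hG) ?Lwi// GE//.
by rewrite RintegralZl//; exact: iwig.
Qed.

(** Testing G against simple multiples of the weight, multiplied by the sign of
    g, yields the integral of f times the absolute value of g in the limit. *)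
Lemma representation_ge0_bound (f : T -> R) :
  f \in Lp -> (forall t, 0 <= f t) ->
  (\int[mu]_t (f t * `|g t|)%:E <= C%:E * 'N[mu]_p%:E[EFin \o f])%E.
Proof.
move=> Lf f0; have mf := Lfun_measurable Lf.
have [s [s0 nds sf cs]] := weighted_approximation mw w0 mf f0.
have [sg sgE] := sign_sfun mg.
have sgg t : sg t * g t = `|g t|.
  by rewrite sgE [RHS]normrEsign ?num_real.
pose h n t := (w t * s n t * `|g t|)%:E.
have mh n : measurable_fun [set: T] (h n).
  apply/measurable_EFinP; apply: measurable_funM => //.
    by apply: measurable_funM.
  exact: measurableT_comp.
have h0 n t : [set: T] t -> (0 <= h n t)%E.
  by move=> _; rewrite lee_fin !mulr_ge0// ltW.
have ndh t : [set: T] t -> {homo h ^~ t : n m / (n <= m)%N >-> (n <= m)%E}.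
  move=> _ m n mn; rewrite lee_fin ler_wpM2r// ler_wpM2l ?nds//.
  exact: ltW.
have ch := @cvg_monotone_convergence _ _ _ mu _ measurableT _ mh h0 ndh.
have -> : (\int[mu]_t (f t * `|g t|)%:E =
    \int[mu]_t (limn (h ^~ t)))%E.
  apply: eq_integral => t _; apply/esym/cvg_lim => //.
  apply: cvg_EFin; first exact: nearW.
  by apply: cvgM; [exact: cs|exact: cvg_cst].
rewrite -(cvg_lim _ ch)//; apply: lime_le.
  by apply/cvg_ex; eexists; exact: ch.
apply: nearW => n.
have [Lws iws Gws] := representation_sfun (s n * sg).
have hE t : h n t = (w t * (s n * sg) t * g t)%:E.
  by rewrite /h sfunM /= !mulrA -(mulrA _ (sg t)) sgg.
have -> : (\int[mu]_t h n t = (G (w \* (s n * sg)))%:E)%E.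
  rewrite Gws /Rintegral fineK; first by apply: eq_integral => t _; exact: hE.
  exact: integrable_fin_num.
apply: (le_trans (le_trans _ (proj2 hG _ Lws))).
  by rewrite lee_fin ler_norm.
apply: lee_wpmul2l; first by rewrite lee_fin.
apply: le_Lnorm => //; first exact: Lfun_measurable Lws.
move=> t; have -> : (w \* (s n * sg)) t = w t * (s n t * sg t) by [].
rewrite !normrM sgE normr_sign mulr1.
by rewrite !ger0_norm ?(ltW (w0 t)).
Qed.

(** Both sides are continuous along the dominated approximation of f by simple
    multiples of the weight: the left one because G is, the right one because
    f g is integrable. *)
Lemma representation_ge0 (f : T -> R) : f \in Lp -> (forall t, 0 <= f t) ->
  mu.-integrable [set: T] (fun t => (f t * g t)%:E) /\
  G f = \int[mu]_t (f t * g t).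
Proof.
move=> Lf f0; have mf := Lfun_measurable Lf.
have [s [s0 nds sf cs]] := weighted_approximation mw w0 mf f0.
have mng : measurable_fun [set: T] (fun t => (f t * `|g t|)%:E).
  by apply/measurable_EFinP; apply: measurable_funM => //;
    exact: measurableT_comp.
have ing : mu.-integrable [set: T] (fun t => (f t * `|g t|)%:E).
  apply/integrableP; split=> //.
  under eq_integral do rewrite gee0_abs ?lee_fin ?mulr_ge0//.
  apply: le_lt_trans (representation_ge0_bound Lf f0) _.
  by rewrite lte_mul_pinfty ?lee_fin//; exact: Lfun_finite_norm Lf.
have mfg : measurable_fun [set: T] (fun t => (f t * g t)%:E).
  by apply/measurable_EFinP; exact: measurable_funM.
have ig : mu.-integrable [set: T] (fun t => (f t * g t)%:E).
  apply: le_integrable ing => // t _ /=.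
  by rewrite lee_fin !normrM normr_id.
split=> //.
have cG : G (w \* s n) @[n --> \oo] --> G f.
  apply: (bounded_linear_on_cvg p1 hG _ mf Lf) => //.
    by move=> n; exact: measurable_funM.
  by move=> n t; rewrite /= ger0_norm ?mulr_ge0 ?(ltW (w0 t)).
have cI : (\int[mu]_t (w t * s n t * g t)%:E @[n --> \oo] -->
    \int[mu]_t (f t * g t)%:E)%E.
  have mwsg n : measurable_fun [set: T] (fun t => (w t * s n t * g t)%:E).
    by apply/measurable_EFinP; apply: measurable_funM => //;
      exact: measurable_funM.
  have cwsg : {ae mu, forall t, [set: T] t ->
      (w t * s n t * g t)%:E @[n --> \oo] --> (f t * g t)%:E}.
    apply/aeW => t _; apply: cvg_EFin; first exact: nearW.
    by apply: cvgM; [exact: cs|exact: cvg_cst].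
  have dwsg : {ae mu, forall t n, [set: T] t ->
      (`|(w t * s n t * g t)%:E| <= (f t * `|g t|)%:E)%E}.
    apply/aeW => t n _; rewrite lee_fin normrM ler_wpM2r//.
    by rewrite ger0_norm ?mulr_ge0 ?(ltW (w0 t)).
  by have [] := dominated_convergence measurableT mwsg mfg cwsg ing dwsg.
apply: (cvg_unique _ cG) => //.
have -> : (fun n => G (w \* s n)) = (fun n => \int[mu]_t (w t * s n t * g t)).
  by apply/funext => n; have [] := representation_sfun (s n).
by apply: fine_cvg; rewrite /Rintegral fineK//; exact: integrable_fin_num.
Qed.

Lemma representation_Lfun (f : T -> R) : f \in Lp ->
  G f = \int[mu]_t (f t * g t).
Proof.
move=> Lf; have mf := Lfun_measurable Lf.
have Lfp : f^\+ \in Lp.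
  apply: Lfun_le Lf => //; first exact: measurable_funrpos.
  move=> t; rewrite (ger0_norm (funrpos_ge0 _ _)) /funrpos.
  by rewrite ge_max ler_norm normr_ge0.
have Lfn : f^\- \in Lp.
  apply: Lfun_le Lf => //; first exact: measurable_funrneg.
  move=> t; rewrite (ger0_norm (funrneg_ge0 _ _)) /funrneg.
  by rewrite ge_max -normrN ler_norm normr_ge0.
have [ip Gp] := representation_ge0 Lfp (funrpos_ge0 f).
have [inn Gn] := representation_ge0 Lfn (funrneg_ge0 f).
rewrite -[in LHS](funrposBneg f) (bounded_linear_onB p1 hG)// Gp Gn.
rewrite -RintegralB//; apply: eq_Rintegral => t _.
by rewrite -mulrBl -[in RHS](funrposBneg f).
Qed.

End representation.

(** * Membership of the kernel in L_q *)

Section dual_membership.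
Context d (T : measurableType d) (R : realType).
Context (mu : {measure set T -> \bar R}).
Context (w : T -> R) (w01 : forall t, 0 < w t <= 1).
Context (iw : mu.-integrable [set: T] (EFin \o w)).
Context (C : R) (C0 : 0 <= C).
Context (g : T -> R) (mg : measurable_fun [set: T] g).

Let w0 t : 0 < w t. Proof. by have /andP[] := w01 t. Qed.

Let mw : measurable_fun [set: T] w.
Proof. by have /integrableP[/measurable_EFinP] := iw. Qed.

Let mng : measurable_fun [set: T] (fun t => `|g t|).
Proof. exact: measurableT_comp. Qed.

(** Testing the bound against w 1_A, where A is the set on which |g| > C, shows
    that w (|g| - C), which is positive on A, has a nonpositive integral over A;
    hence A is negligible. *)
Lemma essentially_bounded_of_dual_bound :
  (forall f, f \in Lfun mu 1%E -> (forall t, 0 <= f t) ->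
    (\int[mu]_t (f t * `|g t|)%:E <= C%:E * 'N[mu]_1[EFin \o f])%E) ->
  g \in Lfun mu +oo%E.
Proof.
move=> gC; pose A := [set t | C < `|g t|].
have mA : measurable A.
  have -> : A = ~` [set t | `|g t| <= C].
    by apply/seteqP; split=> t; rewrite /A /= ltNge => /negP.
  apply: measurableC; rewrite -[X in measurable X]setTI.
  exact: measurable_fun_le.
pose f := w \* \1_A.
have f0 t : 0 <= f t by rewrite /f /= mulr_ge0// ltW.
have mf : measurable_fun [set: T] f.
  by apply: measurable_funM => //; exact: measurable_indic.
have Lf : f \in Lfun mu 1%E.
  apply: (Lfun_le (lexx _) mf _ (Lfun_integrable_le1 (lexx _) w01 iw)) => t.
  rewrite /f /= normrM ler_piMr// indicE.
  by case: (_ \in _); rewrite ?normr1 ?normr0.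
pose h t := f t * (`|g t| - C).
have h0 t : 0 <= h t.
  rewrite /h /f /= indicE; have [tA|tA] := boolP (t \in A).
    by rewrite mulr1 mulr_ge0 ?(ltW (w0 t))// subr_ge0 ltW//; exact: set_mem tA.
  by rewrite mulr0 mul0r.
have mh : measurable_fun [set: T] h.
  by apply: measurable_funM => //; exact: measurable_funB.
have intCf : (\int[mu]_t (C * f t)%:E = C%:E * 'N[mu]_1[EFin \o f])%E.
  rewrite Lnorm1; under eq_integral do rewrite EFinM.
  rewrite ge0_integralZl_EFin//; last 2 first.
  - by move=> t _; rewrite lee_fin.
  - exact/measurable_EFinP.
  by congr (_ * _)%E; apply: eq_integral => t _; rewrite gee0_abs ?lee_fin.
have Nfin : (C%:E * 'N[mu]_1[EFin \o f])%E \is a fin_num.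
  rewrite fin_numM// ge0_fin_numE ?Lnorm_ge0//; exact: Lfun_finite_norm Lf.
have ih : (\int[mu]_t (h t)%:E = 0)%E.
  apply/eqP; rewrite eq_le integral_ge0 ?andbT; last first.
    by move=> t _; rewrite lee_fin.
  rewrite -(subee Nfin) leeBrDr// -[X in (_ + X <= _)%E]intCf.
  rewrite -ge0_integralD//; last 4 first.
  - by move=> t _; rewrite lee_fin.
  - exact/measurable_EFinP.
  - by move=> t _; rewrite lee_fin mulr_ge0.
  - by apply/measurable_EFinP; exact: measurable_funM.
  apply: le_trans (gC f Lf f0); rewrite le_eqVlt; apply/orP; left; apply/eqP.
  apply: eq_integral => t _; rewrite -EFinD /h; congr EFin.
  by rewrite mulrBr (mulrC C) subrK.
rewrite inE; apply/andP; split; rewrite inE//= /finite_norm unlock /Lnorm.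
case: ifPn => // _; apply: le_lt_trans (ltry C).
apply/ess_supP.
have [/(_ _) ae_h _] := ae_eq_integral_abs mu measurableT (f := EFin \o h)
  (iffRL (measurable_EFinP _ _) mh).
have : ae_eq mu [set: T] (EFin \o h) (cst 0%E).
  apply: ae_h; rewrite -[RHS]ih; apply: eq_integral => t _.
  by rewrite gee0_abs ?lee_fin.
apply: filterS => t /= /(_ Logic.I)[]; rewrite /h /f /= indicE => ht.
rewrite lee_fin leNgt; apply/negP => Cg.
move/eqP: ht; rewrite mem_set// mulr1 mulf_eq0 gt_eqF//= subr_eq0 => /eqP gC'.
by rewrite gC' ltxx in Cg.
Qed.

(** The extremal case of Hölder's inequality: testing the bound against
    phi^(q-1), where phi is |g| truncated so as to have a finite norm, yields
    I <= C I^(1/p) for the integral I of phi^q, hence I <= C^q. *)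
Lemma Lfun_conjugate_of_dual_bound (p : R) : 1 < p ->
  (forall f, f \in Lfun mu p%:E -> (forall t, 0 <= f t) ->
    (\int[mu]_t (f t * `|g t|)%:E <= C%:E * 'N[mu]_p%:E[EFin \o f])%E) ->
  g \in Lfun mu (p / (p - 1))%:E.
Proof.
move=> p1 gC; set q := p / (p - 1).
have p0 : 0 < p by rewrite (lt_trans ltr01).
have p10 : 0 < p - 1 by rewrite subr_gt0.
have q0 : 0 < q by rewrite divr_gt0.
have q1p : (q - 1) * p = q.
  by rewrite /q -[X in _ - X](@divff _ (p - 1)) ?gt_eqF// -mulrBl opprB addrC
    subrK mul1r mulrC.
have q1 : 1 <= q.
  by rewrite ler_pdivlMr// mul1r lerBlDr lerDl.
have pq : p^-1 + q^-1 = 1.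
  by rewrite invf_div -[X in X + _]mul1r -mulrDl subrKC divff// gt_eqF.
(* The truncation by a multiple of w is in L_q, and it increases to |g| because
   w is positive everywhere. *)
pose phi (k : nat) t : R := Num.min `|g t| (k%:R * w t).
have phi0 k t : 0 <= phi k t by rewrite le_min normr_ge0 mulr_ge0// ltW.
have mphi k : measurable_fun [set: T] (phi k).
  by apply: measurable_minr => //; exact: measurable_funM.
have Lphi k : phi k \in Lfun mu q%:E.
  apply: (Lfun_le _ (mphi k) _ (LfunZ k%:R _ (Lfun_integrable_le1 q1 w01 iw))).
  - by rewrite lee_fin.
  - by move=> t; rewrite ger0_norm// ger0_norm ?mulr_ge0// ?(ltW (w0 t))//
      ge_min lexx orbT.
  - by rewrite lee_fin.
have mphiq k : measurable_fun [set: T] (fun t => (phi k t `^ q)%:E).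
  have := measurable_normr_powR q (mphi k).
  by under eq_fun do rewrite ger0_norm//.
pose I k := (\int[mu]_t (phi k t `^ q)%:E)%E.
have Iy k : (I k < +oo)%E.
  have /(Lfun_finP mu q1 (mphi k)) := Lphi k.
  by rewrite /I; under eq_integral do rewrite ger0_norm//.
have I0 k : (0 <= I k)%E.
  by apply: integral_ge0 => t _; rewrite lee_fin powR_ge0.
have Ifin k : I k \is a fin_num by rewrite ge0_fin_numE.
have IC k : (I k <= (C `^ q)%:E)%E.
  pose f t := phi k t `^ (q - 1).
  have fpE t : `|f t| `^ p = phi k t `^ q.
    by rewrite ger0_norm ?powR_ge0// -powRrM q1p.
  have mf : measurable_fun [set: T] f.
    exact: (@measurableT_comp _ _ _ _ _ _ (@powR R ^~ (q - 1))).
  have Lf : f \in Lfun mu p%:E.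
    apply/(Lfun_finP mu (ltW p1) mf); under eq_integral do rewrite fpE.
    exact: Iy.
  have Nf : ('N[mu]_p%:E[EFin \o f] = I k `^ p^-1)%E.
    by rewrite LnormE_fin; under eq_integral do rewrite fpE.
  have := gC f Lf (fun t => powR_ge0 _ _).
  rewrite Nf => IleC.
  have : (I k <= C%:E * I k `^ p^-1)%E.
    apply: le_trans IleC; apply: ge0_le_integral => //.
    - by move=> t _; rewrite lee_fin powR_ge0.
    - by apply/measurable_EFinP; exact: measurable_funM.
    move=> t _; rewrite lee_fin -mulr_powRB1// mulrC ler_wpM2l ?powR_ge0//.
    by rewrite ge_min lexx.
  rewrite -[I k]fineK// poweR_EFin -EFinM !lee_fin.
  have r0 : 0 <= fine (I k) by rewrite fine_ge0.
  move: (fine (I k)) r0 => r; rewrite le_eqVlt => /predU1P[<- _|r0].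
    exact: powR_ge0.
  have rE : r `^ q^-1 * r `^ p^-1 = r.
    by rewrite -powRD ?(gt_eqF r0) ?implybT// addrC pq powRr1// ltW.
  rewrite -{1}rE ler_pM2r ?powR_gt0// => rC.
  have -> : r = (r `^ q^-1) `^ q.
    by rewrite -powRrM mulVf ?gt_eqF// powRr1// ltW.
  by apply: ge0_ler_powR => //; rewrite ?nnegrE ?powR_ge0// ltW.
apply/(Lfun_finP mu q1 mg); apply: le_lt_trans (ltry (C `^ q)).
have nd t : [set: T] t ->
    {homo (fun k => (phi k t `^ q)%:E) : m n / (m <= n)%N >-> (m <= n)%E}.
  move=> _ m n mn; rewrite lee_fin ge0_ler_powR ?nnegrE ?(ltW q0)//.
  rewrite le_min ge_min lexx /= ge_min; apply/orP; right.
  by rewrite ler_wpM2r ?(ltW (w0 t))// ler_nat.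
have cI := @cvg_monotone_convergence _ _ _ mu _ measurableT _ mphiq
  (fun k t _ => powR_ge0 _ _) nd.
have -> : (\int[mu]_t (`|g t| `^ q)%:E =
    \int[mu]_t limn (fun k => (phi k t `^ q)%:E))%E.
  apply: eq_integral => t _; apply/esym/cvg_lim => //.
  apply: cvg_near_cst.
  (* For k at least |g t| / w t the truncation is inactive. *)
  exists (Num.truncn (`|g t| / w t)).+1 => // k /= kt.
  rewrite /phi (min_idPl _)// -ler_pdivrMr//.
  apply: (le_trans (ltW (truncnS_gt _))).
  by rewrite ler_nat.
rewrite -(cvg_lim _ cI)//; apply: lime_le.
  by apply/cvg_ex; eexists; exact: cI.
exact: nearW.
Qed.

Lemma Lfun_hoelder_conjugate_of_dual_bound (p : R) : 1 <= p ->
  (forall f, f \in Lfun mu p%:E -> (forall t, 0 <= f t) ->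
    (\int[mu]_t (f t * `|g t|)%:E <= C%:E * 'N[mu]_p%:E[EFin \o f])%E) ->
  g \in Lfun mu (hoelder_conjugate p%:E).
Proof.
rewrite le_eqVlt => /predU1P[<-|p1] gC.
  by rewrite hoelder_conjugate1; exact: essentially_bounded_of_dual_bound.
by rewrite hoelder_conjugate_fin//; exact: Lfun_conjugate_of_dual_bound.
Qed.

End dual_membership.

(** The density, the integral formula and the membership of the kernel in L_q
    hold for any integrable weight, and sigma-finiteness provides one. *)
Theorem Lfun_riesz_representation d (T : measurableType d) (R : realType)
    (mu : {sigma_finite_measure set T -> \bar R}) (p C : R)
    (G : (T -> R) -> R) : 1 <= p -> 0 <= C ->
  bounded_linear_on mu p%:E C G ->
  exists2 g : T -> R, g \in Lfun mu (hoelder_conjugate p%:E) &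
    forall f, f \in Lfun mu p%:E -> G f = \int[mu]_t (f t * g t).
Proof.
move=> p1 C0 hG; have [w [w01 iw]] := sigma_finite_weight mu.
have [g [mg iwg GE]] := bounded_linear_on_density p1 hG w01 iw.
exists g; last by move=> f Lf; exact: (representation_Lfun p1 hG C0 w01 iw mg).
apply: (Lfun_hoelder_conjugate_of_dual_bound w01 iw C0 mg p1) => f Lf f0.
exact: (representation_ge0_bound p1 hG C0 w01 iw mg).
Qed.

Import HBSimple.

(** The sign of g times an integrable positive weight is an admissible test
    function, whose pairing with g is the integral of the absolute value of g
    times that weight. *)
Lemma Lfun_dual_separation d (T : measurableType d) (R : realType)
    (mu : {sigma_finite_measure set T -> \bar R}) (p : R) (g : T -> R) :
  1 <= p -> g \in Lfun mu (hoelder_conjugate p%:E) ->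
  (forall f, f \in Lfun mu p%:E -> \int[mu]_t (f t * g t) = 0) ->
  g = cst 0 %[ae mu].
Proof.
move=> p1 Lg g0; have [w [w01 iw]] := sigma_finite_weight mu.
have w0 t : 0 < w t by have /andP[] := w01 t.
have mg := Lfun_measurable Lg.
have mw : measurable_fun [set: T] w.
  by have /integrableP[/measurable_EFinP] := iw.
have [s sE] := sign_sfun mg.
pose f t := w t * s t.
have mf : measurable_fun [set: T] f by exact: measurable_funM.
have Lf : f \in Lfun mu p%:E.
  apply: Lfun_le (Lfun_integrable_le1 p1 w01 iw) => // t.
  by rewrite normrM sE normr_sign mulr1.
have fg t : f t * g t = w t * `|g t|.
  by rewrite /f sE -mulrA [in RHS]normrEsign ?num_real.
have ifg := Lfun_mul_integrable p1 Lf Lg.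
have mfg : measurable_fun [set: T] (fun t => (f t * g t)%:E).
  exact: measurable_int ifg.
have : (\int[mu]_t `|(f t * g t)%:E| = 0)%E.
  have <- : (\int[mu]_t (f t * g t)%:E = 0)%E.
    rewrite -[RHS](congr1 EFin (g0 f Lf)) /Rintegral fineK//.
    exact: integrable_fin_num.
  apply: eq_integral => t _.
  by rewrite gee0_abs// lee_fin fg mulr_ge0// ltW.
move/(ae_eq_integral_abs mu measurableT mfg).
apply: filterS => t /= /(_ Logic.I)[]; rewrite fg => /eqP.
by rewrite mulf_eq0 gt_eqF//= normr_eq0 => /eqP.
Qed.

(** * From continuity at zero to a bound *)

(** Rescaling a function f so that its norm becomes half of the radius r bounds
    G f by 2 / r times the norm of f. If f has norm zero, then so have all its
    multiples, and G f vanishes. *)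
Lemma bounded_of_small d (T : measurableType d) (R : realType)
    (mu : {measure set T -> \bar R}) (p : \bar R) (G : (T -> R) -> R)
    (r : R) : (1 <= p)%E -> 0 < r ->
  (forall c f g, f \in Lfun mu p -> g \in Lfun mu p ->
     G (c *: f + g) = c * G f + G g) ->
  (forall f, f \in Lfun mu p -> fine 'N[mu]_p[EFin \o f]%E < r ->
     `|G f| < 1) ->
  bounded_linear_on mu p (2 / r) G.
Proof.
move=> p1 r0 Glin Gsmall; split=> // f Lf.
have L0 : 0 \in Lfun mu p by have [] := Lfun_submod_closed mu p1.
have G0 : G 0 = 0.
  have := Glin 1 0 0 L0 L0.
  by rewrite scale1r addr0 mul1r -[X in X = _]addr0 => /addrI/esym.
have GZ c : G (c *: f) = c * G f.
  by rewrite -[c *: f]addr0 Glin// G0 addr0.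
have Nfin : 'N[mu]_p[EFin \o f]%E \is a fin_num.
  by rewrite ge0_fin_numE ?Lnorm_ge0//; exact: Lfun_finite_norm Lf.
have NZ c : fine 'N[mu]_p[EFin \o (c *: f)]%E =
    `|c| * fine 'N[mu]_p[EFin \o f]%E.
  have -> : 'N[mu]_p[EFin \o (c *: f)%R]%E = (`|c|%:E * 'N[mu]_p[EFin \o f])%E.
    exact: (LnormZ (Lfun_Sub p1 Lf) c).
  by rewrite fineM.
have N0 : 0 <= fine 'N[mu]_p[EFin \o f]%E by rewrite fine_ge0// Lnorm_ge0.
have small c : 0 < c -> c * fine 'N[mu]_p[EFin \o f]%E < r -> c * `|G f| < 1.
  move=> c0 cN; have := Gsmall (c *: f) (LfunZ c p1 Lf).
  by rewrite NZ GZ normrM (gtr0_norm c0); exact.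
rewrite -[X in (_ <= _ * X)%E]fineK// -EFinM lee_fin.
move: (fine _) N0 small => N; rewrite le_eqVlt => /predU1P[<- small|N0 small].
  rewrite mulr0 leNgt; apply/negP => Gf0.
  have := small `|G f|^-1; rewrite invr_gt0 mulr0 => /(_ Gf0 r0).
  by rewrite mulVf ?gt_eqF// ltxx.
have c0 : 0 < r / (2 * N) by rewrite divr_gt0 ?mulr_gt0.
have Nneq0 : N != 0 by rewrite gt_eqF.
have rneq0 : r != 0 by rewrite gt_eqF.
have cN : r / (2 * N) * N = r / 2 by field.
have -> : 2 / r * N = (r / (2 * N))^-1 by field; rewrite rneq0 Nneq0.
rewrite -div1r ler_pdivlMr// mulrC ltW// small// cN.
by rewrite ltr_pdivrMr// ltr_pMr// ltr1n.
Qed.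

(** * Lebesgue measure on the half-line *)

Section sigma_finite_lebesgue_Rplus.
Context {R : realType}.

Lemma sigma_finite_lebesgue_Rplus :
  sigma_finite [set: measurableTypeR R] (@lebesgue_Rplus R).
Proof.
have [F UF mF] := sigma_finiteT (@lebesgue_measure R).
exists F => // k; have [mFk Fky] := mF k; split => //.
apply: le_lt_trans Fky; rewrite /= /lebesgue_Rplus /= /mrestr.
apply: le_measure; rewrite ?inE//; apply: measurableI => //.
exact: measurable_Rplus.
Qed.

(** The measure underlying this structure is convertible to [lebesgue_Rplus], so
    that results on sigma-finite measures apply to the latter. *)
Definition sigma_finite_Rplus :
    {sigma_finite_measure set (measurableTypeR R) -> \bar R} :=
  HB.pack (mrestr (@lebesgue_measure R) (@measurable_Rplus R))
    (Measure_isSigmaFinite.Build _ _ _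
      (mrestr (@lebesgue_measure R) (@measurable_Rplus R))
      sigma_finite_lebesgue_Rplus).

End sigma_finite_lebesgue_Rplus.

(** * Vector-valued functions and their limits *)

Section vector_valued.
Context {R : realType} {n : nat}.

Local Notation V := (measurableTypeR R -> 'cV[R]_n).
Local Notation mu := (@lebesgue_Rplus R).


Lemma enorm_le_sum (u : 'cV[R]_n) : enorm u <= \sum_i `|u i 0|.
Proof.
have s0 : 0 <= \sum_i `|u i 0| by exact: sumr_ge0.
rewrite -[leRHS](ger0_norm s0) -sqrtr_sqr ler_wsqrtr// dotvE expr2 mulr_suml.
apply: ler_sum => i _; rewrite -expr2 -normr_id -real_normK ?num_real// expr2.
rewrite normr_id ler_wpM2l// (bigD1 i)//= lerDl.
exact: sumr_ge0.
Qed.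

Lemma measurable_enorm (x : V) :
  (forall i, measurable_fun [set: measurableTypeR R] (fun t => x t i 0)) ->
  measurable_fun [set: measurableTypeR R] (fun t => enorm (x t)).
Proof.
move=> mx; have -> : (fun t => enorm (x t)) =
    Num.sqrt \o (fun t => \sum_i x t i 0 * x t i 0).
  by apply/funext => t /=; rewrite /enorm dotvE.
apply: measurableT_comp.
  exact: continuous_measurable_fun (@sqrt_continuous R).
by apply: measurable_sum => j; exact: measurable_funM.
Qed.

(** The Euclidean norm lies between the absolute value of any coordinate and
    the sum of these absolute values. *)
Lemma LpP (q : \bar R) (x : V) : (1 <= q)%E ->
  Lp q x <-> forall i, (fun t => x t i 0) \in Lfun mu q.
Proof.
move=> q1; split=> [[mx fx] i|Lx].
  have me := measurable_enorm mx.
  have Le : (fun t => enorm (x t)) \in Lfun mu q.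
    by rewrite inE; apply/andP; split; rewrite inE.
  apply: (Lfun_le q1 (mx i) _ Le) => t.
  by rewrite (le_trans (le_coord_enorm _ i))// ler_norm.
have mx i := Lfun_measurable (Lx i).
split=> //; have me := measurable_enorm mx.
have Ls : \sum_i (fun t => `|x t i 0|) \in Lfun mu q.
  apply: Lfun_sum => // i; apply: (Lfun_le q1 _ _ (Lx i)).
    exact: measurableT_comp.
  by move=> t; rewrite normr_id.
have /Lfun_finite_norm// : (fun t => enorm (x t)) \in Lfun mu q.
apply: (Lfun_le q1 me _ Ls) => t.
rewrite ger0_norm ?sqrtr_ge0// (le_trans (enorm_le_sum _))//.
by rewrite fct_sumE ler_norm.
Qed.

Lemma Lp_scaleD (q : \bar R) c (x z : V) : (1 <= q)%E ->
  Lp q x -> Lp q z -> Lp q (c *: x + z).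
Proof.
move=> q1 /(LpP x q1) Lx /(LpP z q1) Lz; apply/(LpP _ q1) => i.
have -> : (fun t => (c *: x + z) t i 0) =
    c *: (fun t => x t i 0) + (fun t => z t i 0).
  by apply/funext => t; rewrite !fctE !mxE.
by apply: LfunD => //; exact: LfunZ.
Qed.

Lemma Lp0 (q : \bar R) : (1 <= q)%E -> Lp q (0 : V).
Proof.
move=> q1; apply/(LpP _ q1) => i.
have -> : (fun t : measurableTypeR R => (0 : V) t i 0) = 0.
  by apply/funext => t; rewrite -[LHS]/((0 : 'cV[R]_n) i 0) mxE.
by have [] := Lfun_submod_closed mu q1.
Qed.

Definition coord_fun (i : 'I_n) (f : measurableTypeR R -> R) : V :=
  fun t => f t *: delta_mx i 0.

Lemma Lp_coord_fun (q : \bar R) i f : (1 <= q)%E -> f \in Lfun mu q ->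
  Lp q (coord_fun i f).
Proof.
move=> q1 Lf; apply/(LpP _ q1) => j.
have -> : (fun t => coord_fun i f t j 0) = (j == i)%:R *: f.
  by apply/funext => t; rewrite /coord_fun !mxE eqxx andbT mulrC.
exact: LfunZ.
Qed.

Lemma enorm_coord_fun i f t : enorm (coord_fun i f t) = `|f t|.
Proof.
rewrite /enorm dotvE (bigD1 i)//= big1 ?addr0.
  by rewrite /coord_fun !mxE !eqxx mulr1 -expr2 sqrtr_sqr.
by move=> j ji; rewrite /coord_fun !mxE (negbTE ji) !mulr0.
Qed.

Lemma sum_coord_fun (x : V) : x = \sum_i coord_fun i (fun t => x t i 0).
Proof.
apply/funext => t; rewrite fct_sumE; apply/matrixP => j k.
rewrite (ord1 k) summxE (bigD1 j)//= big1 ?addr0.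
  by rewrite /coord_fun !mxE !eqxx mulr1.
by move=> i ij; rewrite /coord_fun !mxE eq_sym (negbTE ij) mulr0.
Qed.

Section Lplim_theory.
Context (p : R) (p1 : 1 <= p).

Let p1E : (1 <= p%:E)%E. Proof. by rewrite lee_fin. Qed.

Lemma Lplim_Lp (x : V) : Lp p%:E x -> Lplim p x.
Proof. by move=> Lx; exists 0; rewrite (_ : x - cst 0 = x)// subr0. Qed.

Lemma at_infty_Lp (x : V) : Lp p%:E x -> at_infty p x = 0.
Proof.
by move=> Lx; apply: at_inftyE => //; rewrite (_ : x - cst 0 = x)// subr0.
Qed.

Lemma at_infty_cst (a : 'cV[R]_n) : at_infty p (cst a) = a.
Proof. by apply: at_inftyE => //; rewrite subrr; exact: Lp0. Qed.

Lemma Lplim_cst (a : 'cV[R]_n) : Lplim p (cst a).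
Proof. by exists a; rewrite subrr; exact: Lp0. Qed.

Lemma Lp_sub_at_infty (x : V) : Lplim p x -> Lp p%:E (x - cst (at_infty p x)).
Proof. by move=> [a xa]; rewrite (at_inftyE p1 xa). Qed.

Lemma Lplim_scaleD c (x z : V) : Lplim p x -> Lplim p z -> Lplim p (c *: x + z).
Proof.
move=> [a xa] [b zb]; exists (c *: a + b).
have -> : c *: x + z - cst (c *: a + b) = c *: (x - cst a) + (z - cst b).
  by apply/funext => t; rewrite !fctE scalerBr opprD addrACA.
exact: Lp_scaleD.
Qed.

Lemma Lplim_sum (I : Type) (s : seq I) (x : I -> V) :
  (forall i, Lplim p (x i)) -> Lplim p (\sum_(i <- s) x i).
Proof.
move=> Lx; elim/big_ind : _ => [|u v Lu Lv|i _]; last exact: Lx.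
- exact/Lplim_Lp/Lp0.
- by rewrite -[u]scale1r; exact: Lplim_scaleD.
Qed.

Lemma Lplim_norm_coord_fun i f : f \in Lfun mu p%:E ->
  Lplim_norm p (coord_fun i f) = fine 'N[mu]_p%:E[EFin \o f]%E.
Proof.
move=> Lf; have p0 : 0 < p by rewrite (lt_le_trans ltr01).
have Lc := Lp_coord_fun i p1E Lf.
rewrite /Lplim_norm at_infty_Lp//.
have -> : coord_fun i f - cst 0 = coord_fun i f by exact: subr0.
have -> : enorm (0 : 'cV[R]_n) = 0.
  by rewrite /enorm dotvE big1 ?sqrtr0// => j _; rewrite mxE mul0r.
have -> : Lp_norm p%:E (coord_fun i f) = fine 'N[mu]_p%:E[EFin \o f]%E.
  rewrite /Lp_norm -[in RHS]Lnorm_abse; congr (fine (Lnorm _ _ _)).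
  by apply/funext => t /=; rewrite enorm_coord_fun.
rewrite (powR0 (lt0r_neq0 p0)) addr0 -powRrM mulfV ?gt_eqF// powRr1//.
by rewrite fine_ge0// Lnorm_ge0.
Qed.

Section dual.
Context (F : V -> R) (FP : Lplim_dual p F).

Let Flin c (x z : V) : Lplim p x -> Lplim p z -> F (c *: x + z) = c * F x + F z.
Proof. by have [_ + _] := FP; apply. Qed.

Let L0 : Lplim p (0 : V). Proof. exact/Lplim_Lp/Lp0. Qed.

Lemma Lplim_dual0 : F 0 = 0.
Proof.
have := Flin 1 L0 L0.
by rewrite scale1r addr0 mul1r -[X in X = _]addr0 => /addrI/esym.
Qed.

Lemma Lplim_dualD (x z : V) : Lplim p x -> Lplim p z -> F (x + z) = F x + F z.
Proof. by move=> Lx Lz; rewrite -[in LHS](scale1r x) Flin// mul1r. Qed.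

Lemma Lplim_dual_sum (I : Type) (s : seq I) (x : I -> V) :
  (forall i, Lplim p (x i)) -> F (\sum_(i <- s) x i) = \sum_(i <- s) F (x i).
Proof.
move=> Lx; elim: s => [|i s IH]; first by rewrite !big_nil Lplim_dual0.
by rewrite !big_cons Lplim_dualD ?IH//; exact: Lplim_sum.
Qed.

Lemma Lplim_dual_cst (a : 'cV[R]_n) :
  F (cst a) = ((\col_i F (cst (delta_mx i 0)))^T *m a) 0 0.
Proof.
have -> : cst a = \sum_i a i 0 *: cst (delta_mx i 0) :> V.
  apply/funext => t; rewrite fct_sumE; apply/matrixP => j k.
  rewrite (ord1 k) summxE (bigD1 j)//= big1 ?addr0.
    by rewrite !fctE !mxE !eqxx mulr1.
  by move=> i ij; rewrite !fctE !mxE eq_sym (negbTE ij) mulr0.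
have Lc i : Lplim p (a i 0 *: cst (delta_mx i 0) : V).
  by rewrite -[_ *: _]addr0; apply: Lplim_scaleD => //; exact: Lplim_cst.
rewrite Lplim_dual_sum// -[RHS]/(dotv _ _) dotvE; apply: eq_bigr => i _.
rewrite -[_ *: _]addr0 Flin ?Lplim_dual0 ?addr0; [|exact: Lplim_cst|exact: L0].
by rewrite mxE mulrC.
Qed.

(** The restriction of F to the functions along one coordinate axis is a bounded
    functional on the scalar space, hence is given by a kernel. *)
Lemma Lplim_dual_coord i : exists2 g : measurableTypeR R -> R,
  g \in Lfun mu (hoelder_conjugate p%:E) &
  forall f, f \in Lfun mu p%:E -> F (coord_fun i f) = \int[mu]_t (f t * g t).
Proof.
have [_ _ Fcont] := FP.
have [r r0 Fr] := Fcont 0 L0 1 ltr01.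
apply: (@Lfun_riesz_representation _ _ _ (@sigma_finite_Rplus R) p (2 / r))
  => //.
  by rewrite divr_ge0// ltW.
apply: bounded_of_small => //.
  move=> c f h Lf Lh.
  have -> : coord_fun i (c *: f + h) = c *: coord_fun i f + coord_fun i h.
    by apply/funext => t; rewrite /coord_fun !fctE scalerDl scalerA.
  by rewrite Flin//; apply/Lplim_Lp/Lp_coord_fun.
move=> f Lf Nf; have := Fr (coord_fun i f).
rewrite Lplim_dual0 !subr0 Lplim_norm_coord_fun//; apply=> //.
exact/Lplim_Lp/Lp_coord_fun.
Qed.

End dual.
End Lplim_theory.

(** Testing against the functions along one coordinate axis reduces the claim to
    the scalar case. *)
Lemma Lp_dual_separation (p : R) (y z : V) : 1 <= p ->
  Lp (hoelder_conjugate p%:E) y -> Lp (hoelder_conjugate p%:E) z ->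
  (forall i f, f \in Lfun mu p%:E ->
    \int[mu]_t dotv (y t) (coord_fun i f t) =
    \int[mu]_t dotv (z t) (coord_fun i f t)) ->
  y = z %[ae mu].
Proof.
move=> p1; have q1 : (1 <= hoelder_conjugate p%:E)%E.
  by rewrite hoelder_conj_ge1// lee_fin.
move=> /(LpP y q1) Ly /(LpP z q1) Lz yz.
have dotv_coord (u : V) i f t : dotv (u t) (coord_fun i f t) = f t * u t i 0.
  rewrite dotvE (bigD1 i)//= big1 ?addr0.
    by rewrite /coord_fun !mxE !eqxx mulr1 mulrC.
  by move=> j ji; rewrite /coord_fun !mxE (negbTE ji) !mulr0.
have yzi i : (fun t => y t i 0) - (fun t => z t i 0) = cst 0 %[ae mu].
  apply: (@Lfun_dual_separation _ _ _ (@sigma_finite_Rplus R) p) => //.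
    exact: LfunB.
  move=> f Lf; under eq_Rintegral do rewrite mulrBr.
  rewrite RintegralB//; last 2 first.
    exact: Lfun_mul_integrable p1 Lf (Ly i).
    exact: Lfun_mul_integrable p1 Lf (Lz i).
  apply/eqP; rewrite subr_eq0; apply/eqP.
  have := yz i f Lf.
  by under eq_Rintegral do rewrite dotv_coord;
    under [in RHS]eq_Rintegral do rewrite dotv_coord.
have : \forall t \ae mu, forall i, y t i 0 - z t i 0 = 0.
  by apply: filter_forall => i; apply: filterS (yzi i) => t /(_ Logic.I).
apply: filterS => t yzt _; apply/matrixP => i j; rewrite (ord1 j).
by apply/eqP; rewrite -subr_eq0; apply/eqP; exact: yzt.
Qed.

End vector_valued.

(** * The representation theorem *)

Theorem lemma5p1 (R : realType) (n : nat) (p : R)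
    (F : (measurableTypeR R -> 'cV[R]_n) -> R) :
  (1 <= n)%N -> 1 <= p -> Lplim_dual p F ->
  let q : \bar R := hoelder_conjugate p%:E in
  let represents (y : measurableTypeR R -> 'cV[R]_n) (alpha : 'cV[R]_n) :=
    forall x : measurableTypeR R -> 'cV[R]_n, Lplim p x ->
      F x = (\int[lebesgue_Rplus]_t dotv (y t) (x t - at_infty p x))
            + (alpha^T *m at_infty p x) 0 0 in
  exists (y : measurableTypeR R -> 'cV[R]_n) (alpha : 'cV[R]_n),
    [/\ Lp q y,
        represents y alpha
      & forall (y' : measurableTypeR R -> 'cV[R]_n) (alpha' : 'cV[R]_n),
          Lp q y' -> represents y' alpha' ->
          y' = y %[ae lebesgue_Rplus] /\ alpha' = alpha].
Proof.
move=> _ p1 FP q represents.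
have p1E : (1 <= p%:E)%E by rewrite lee_fin.
have q1 : (1 <= q)%E by exact: hoelder_conj_ge1.
have /choice[g gP] i : exists gi : measurableTypeR R -> R,
    gi \in Lfun lebesgue_Rplus q /\ forall f, f \in Lfun lebesgue_Rplus p%:E ->
      F (coord_fun i f) = \int[lebesgue_Rplus]_t (f t * gi t).
  by have [g Lg Fg] := Lplim_dual_coord p1 FP i; exists g.
pose y : measurableTypeR R -> 'cV[R]_n := fun t => \col_i g i t.
pose alpha : 'cV[R]_n := \col_i F (cst (delta_mx i 0)).
have yE i : (fun t => y t i 0) = g i by apply/funext => t; rewrite mxE.
have Ly : Lp q y by apply/(LpP y q1) => i; rewrite yE; have [] := gP i.
have rep : represents y alpha.
  move=> x Lx; set a := at_infty p x.
  have Lx0 : Lp p%:E (x - cst a) := Lp_sub_at_infty p1 Lx.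
  have Lxi i : (fun t => (x - cst a) t i 0) \in Lfun lebesgue_Rplus p%:E.
    exact: (LpP _ p1E).1 Lx0 i.
  rewrite -[in LHS](subrK (cst a) x) (Lplim_dualD FP); last 2 first.
  - exact: Lplim_Lp.
  - exact: Lplim_cst.
  rewrite (Lplim_dual_cst p1 FP); congr (_ + _).
  rewrite [in LHS](sum_coord_fun (x - cst a)).
  rewrite (Lplim_dual_sum p1 FP); last first.
    by move=> i; apply/Lplim_Lp/Lp_coord_fun.
  rewrite (eq_bigr (fun i => \int[lebesgue_Rplus]_t
    ((x - cst a) t i 0 * g i t))); last by move=> i _; have [_ ->] := gP i.
  rewrite -Rintegral_sum; last first.
    by move=> i; apply: Lfun_mul_integrable p1 (Lxi i) _; have [] := gP i.
  apply: eq_Rintegral => t _; rewrite dotvE; apply: eq_bigr => i _.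
  by rewrite mulrC [in RHS]mxE.
exists y, alpha; split=> // y' alpha' Ly' rep'; split.
  (* A function in L_p has limit zero, so alpha and alpha' drop out. *)
  apply: (Lp_dual_separation p1 Ly' Ly) => i f Lf.
  have Lc := Lp_coord_fun i p1E Lf.
  have := rep _ (Lplim_Lp Lc); rewrite (rep' _ (Lplim_Lp Lc)).
  rewrite (at_infty_Lp p1 Lc) !mulmx0 => /addIr.
  by under eq_Rintegral do rewrite subr0;
    under [in RHS]eq_Rintegral do rewrite subr0.
have dot_delta (b : 'cV[R]_n) i :
    (b^T *m (delta_mx i 0 : 'cV[R]_n)) 0 0 = b i 0.
  by rewrite -colE !mxE.
apply/matrixP => i j; rewrite (ord1 j).
(* A constant function equals its limit, so y and y' drop out. *)
have Lc := Lplim_cst p1 (delta_mx i 0 : 'cV[R]_n).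
have := rep _ Lc; rewrite (rep' _ Lc) (at_infty_cst p1) !dot_delta.
have int0 (z : measurableTypeR R -> 'cV[R]_n) : \int[lebesgue_Rplus]_t
    dotv (z t) (cst (delta_mx i 0) t - delta_mx i 0) = 0.
  under eq_Rintegral do rewrite /= subrr /dotv mulmx0 mxE.
  by rewrite Rintegral_cst// mul0r.
by rewrite !int0 !add0r.
Qed.
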